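(* Let $d \ge 1$, let $\|\cdot\|_*$ be either a $C^1$ norm or a polyhedral norm on $\mathbb{R}^d$, and let $E \subseteq \mathbb{R}^d$ be a nonempty set. Then for every $\varepsilon > 0$ there exists $x \in E$ such that $$\dim_P \Delta_x^*(E) \ge \frac{1}{d}\dim_P E - \varepsilon.$$ In particular, $$\dim_P \Delta^*(E) \ge \frac{1}{d}\dim_P E.$$
   Context: A $C^1$ norm on $\mathbb{R}^d$ is a norm that is continuously differentiable on $\mathbb{R}^d \setminus \{0\}$. A polyhedral norm is a norm of the form $\|x\|_* = \max_{1 \le i \le M} |\langle x, v_i\rangle|$ for some finite collection of vectors $v_1,\dots,v_M \in \mathbb{R}^d$ (equivalently, its unit ball is a polytope). For a norm $\|\cdot\|_*$, a set $E \subseteq \mathbb{R}^d$ and a point $x \in \mathbb{R}^d$: $\Delta^*(E) := \{\|y-x\|_* : x,y \in E\} \subseteq [0,\infty)$ (distance set) and $\Delta_x^*(E) := \{\|y-x\|_* : y \in E\} \subseteq [0,\infty)$ (pinned distance set at $x$). For bounded $E \subset \mathbb{R}^n$, let $N(E,\delta)$ be the minimal number of balls of radius $\delta$ needed to cover $E$, and let the upper box dimension be $\overline{\dim}_B E := \limsup_{\delta \to 0} \frac{\log N(E,\delta)}{-\log\delta}$. For arbitrary $E \subseteq \mathbb{R}^n$ the packing dimension is $\dim_P E := \inf\{\sup_{i \ge 1} \overline{\dim}_B E_i : E \subseteq \bigcup_{i=1}^\infty E_i\}$, the infimum being over countable covers of $E$ by bounded sets. *)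

(* Defs.v *)
From HB Require Import structures.
From mathcomp Require Import all_boot all_order all_algebra.
From mathcomp Require Import all_classical all_reals all_analysis.
Import Order.TTheory GRing.Theory Num.Theory.
Import numFieldNormedType.Exports.

Set Implicit Arguments.
Unset Strict Implicit.
Unset Printing Implicit Defensive.

Local Open Scope classical_set_scope.
Local Open Scope ring_scope.

(* The norm carried by the library's normed module 'rV[R]_d is the sup norm;
   the inner product and the Euclidean distance are therefore spelled out. *)
Definition inner (R : realType) (d : nat) (x y : 'rV[R]_d) : R :=
  \sum_(i < d) x 0 i * y 0 i.

Definition euclidean_dist (R : realType) (d : nat) (x y : 'rV[R]_d) : R :=
  Num.sqrt (inner (x - y) (x - y)).

Definition real_dist (R : realType) (s t : R) : R := `|s - t|.

Definition is_norm (R : realType) (d : nat) (N : 'rV[R]_d -> R) : Prop :=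
  [/\ forall x, 0 <= N x,
      forall x, N x = 0 -> x = 0,
      forall (a : R) x, N (a *: x) = `|a| * N x
    & forall x y, N (x + y) <= N x + N y].

(* As R^d has finite dimension, x |-> 'd N x is continuous into the space of
   linear forms iff x |-> 'd N x v is continuous for every v. *)
Definition C1_away_from_0 (R : realType) (d : nat) (N : 'rV[R]_d -> R) : Prop :=
  forall x : 'rV[R]_d, x != 0 ->
    differentiable N x /\
    forall v : 'rV[R]_d, {for x, continuous (fun y => 'd N y v)}.

(* The terms are nonnegative, so 0 as the initial value does not affect the
   maximum. *)
Definition polyhedral (R : realType) (d : nat) (N : 'rV[R]_d -> R) : Prop :=
  exists (M : nat) (v : 'I_M -> 'rV[R]_d),
    forall x, N x = \big[Num.max/0]_(i < M) `|inner x (v i)|.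

Definition distance_set (R : realType) (d : nat) (N : 'rV[R]_d -> R)
    (E : set 'rV[R]_d) : set R :=
  [set t | exists x y, [/\ E x, E y & t = N (y - x)]].

Definition pinned_distance_set (R : realType) (d : nat) (N : 'rV[R]_d -> R)
    (E : set 'rV[R]_d) (x : 'rV[R]_d) : set R :=
  [set N (y - x) | y in E].

Section PackingDimension.
Context (R : realType) (T : Type) (dist : T -> T -> R).

Definition dist_bounded (E : set T) : Prop :=
  exists (c : T) (r : R), forall x, E x -> dist x c <= r.

Definition covered_by (E : set T) (delta : R) (n : nat) : Prop :=
  exists c : 'I_n -> T, forall x, E x -> exists i, dist x (c i) <= delta.

(* An infimum of naturals is attained as soon as some finite cover exists; it
   is +oo otherwise. *)
Definition covering_number (E : set T) (delta : R) : \bar R :=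
  ereal_inf [set (n%:R)%:E | n in covered_by E delta].

(* The library's conventions give lne 0 = -oo, hence dimension -oo to the empty
   set. *)
Definition upper_box_dim (E : set T) : \bar R :=
  limf_esup (fun delta : R =>
    (lne (covering_number E delta) * ((- ln delta)^-1)%:E)%E) 0^'+.

Definition packing_dim (E : set T) : \bar R :=
  ereal_inf
    [set ereal_sup [set upper_box_dim (F i) | i in [set: nat]]
      | F in [set F : nat -> set T |
               (forall i, dist_bounded (F i)) /\ E `<=` \bigcup_i F i]].

End PackingDimension.

(* Main.v *)
Require Import Defs.
From HB Require Import structures.
From mathcomp Require Import all_boot all_order all_algebra.
From mathcomp Require Import all_classical all_reals all_analysis.
From mathcomp Require Import ring lra.
Import Order.TTheory GRing.Theory Num.Theory.
Import numFieldNormedType.Exports.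

(** If [E] is covered by countably many pieces on each of which
    [y |-> (N (y - x_1), ..., N (y - x_d))] has a Lipschitz inverse for some pins
    [x_i] in [E], then covering the [d] pinned distance sets covers the piece,
    whence [packing_dim E <= d * s] as soon as every pinned distance set has
    packing dimension below [s].

    To find the pieces for a [C^1] norm, stratify [E] by the largest number [k]
    of linearly independent gradients [grad N (y - x_i)] with [x_i] in [E].
    Fix [y0] and [k] such pins.  If the Lipschitz bound fails for pairs [y, y']
    of the stratum tending to [y0] with [y - y'] tending to the direction [w],
    then all the gradients at [y0] vanish on [w].  But [y'] is itself a pin for
    [y], and [grad N (y - y')] tends to [grad N w], which takes the value
    [N w > 0] at [w]: near [y0] it is a [(k+1)]-st independent gradient, a
    contradiction.

    For a polyhedral norm, let [active z] be the set of the [i] with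
    [N z = |<z, v_i>|], and stratify [E] by the family of all
    [active (y - x)], [x] in [E].  Active sets can only shrink under small
    perturbations, so along a stratum the minimal members of the family are
    locally attained at fixed pins, and there [N (y - x)] is affine in [y].
    Since [active (y - y')] contains a minimal member, [N (y - y')] is
    controlled by those affine functions, at most [d] of which are needed. *)

Set Implicit Arguments.
Unset Strict Implicit.
Unset Printing Implicit Defensive.

Local Open Scope classical_set_scope.
Local Open Scope ring_scope.

(** * Covering numbers and packing dimension *)

Section BoxDim.
Context (R : realType) (T : Type) (dist : T -> T -> R).
Implicit Types (E F : set T) (s : R).

Lemma near0_ge_Nln (K : R) : \forall delta \near (0 : R)^'+, K <= - ln delta.
Proof.
near=> delta; rewrite lerNr -(expRK (- K)) ler_ln ?posrE ?expR_gt0 //.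
by near: delta; exact: nbhs_right_le (expR_gt0 _).
Unshelve. all: by end_near. Qed.

(** Here [expR (s * - ln delta)] is [delta] to the power [-s]. A limsup below [s] bounds the
    quotient by [s] at all small scales, and the infimum defining the covering number then supplies
    an actual cover. *)
Lemma upper_box_dim_lt E s : (upper_box_dim dist E < s%:E)%E ->
  \forall delta \near (0 : R)^'+,
    exists2 n, Defs.covered_by dist E delta n & n%:R <= expR (s * - ln delta).
Proof.
move=> /ereal_inf_lt[_ [V V0 <-]] supVs.
near=> delta.
have L0 : 0 < - ln delta.
  by apply: (@lt_le_trans _ _ 1) => //; near: delta; exact: near0_ge_Nln.
have Vd : V delta by near: delta.
have covlt : (covering_number dist E delta < (expR (s * - ln delta))%:E)%E.
  have : (lne (covering_number dist E delta) < (s * - ln delta)%:E)%E.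
    rewrite EFinM -lte_pdivrMr //.
    by apply: le_lt_trans supVs; apply: ereal_sup_ubound; exists delta.
  have cov0 : (0 <= covering_number dist E delta)%E.
    by apply: le_ereal_inf_tmp => _ [n _ <-]; rewrite lee_fin.
  rewrite -{1}(expRK (s * - ln delta)) -lne_EFin ?expR_gt0 // lte_lne //.
    by rewrite in_itv/= cov0 leey.
  by rewrite in_itv/= leey lee_fin expR_ge0.
have [_ [n covn <-]] := ereal_inf_lt covlt.
by rewrite lte_fin => /ltW ?; exists n.
Unshelve. all: by end_near. Qed.

(** The constant [C] is invisible in the limit, since [ln C / - ln delta] tends to 0. *)
Lemma upper_box_dim_le E (C s : R) : 0 < C ->
  (\forall delta \near (0 : R)^'+,
    exists2 n, Defs.covered_by dist E delta n & n%:R <= C * expR (s * - ln delta)) ->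
  (upper_box_dim dist E <= s%:E)%E.
Proof.
move=> C0 H; apply/lee_addgt0Pr => e e0.
have HV : (0 : R)^'+ [set delta : R |
    (lne (covering_number dist E delta) * ((- ln delta)^-1)%:E <= (s + e)%:E)%E].
  near=> delta => /=.
  have L1 : 1 <= - ln delta by near: delta; exact: near0_ge_Nln.
  (* This threshold makes [C] at most [delta] to the power [-e]. *)
  have L2 : ln C / e <= - ln delta by near: delta; exact: near0_ge_Nln.
  have L0 : 0 < - ln delta by exact: lt_le_trans L1.
  rewrite lee_pdivrMr // -EFinM.
  have [n covn nle] : exists2 n, Defs.covered_by dist E delta n &
      n%:R <= C * expR (s * - ln delta) by near: delta.
  rewrite -(expRK ((s + e) * - ln delta)) -lne_EFin ?expR_gt0 // lee_lne.
  - apply: (@le_trans _ _ (n%:R)%:E); first by apply: ereal_inf_lbound; exists n.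
    rewrite lee_fin (le_trans nle) // mulrDl addrC expRD.
    rewrite ler_wpM2r ?expR_ge0 // -{1}(lnK C0) ler_expR.
    by rewrite mulrC -ler_pdivrMr.
  - rewrite in_itv/= leey andbT; apply: le_ereal_inf_tmp => _ [m _ <-].
    by rewrite lee_fin.
  - by rewrite in_itv/= leey lee_fin expR_ge0.
apply: (@le_trans _ _ (ereal_sup [set (lne (covering_number dist E delta) *
    ((- ln delta)^-1)%:E)%E | delta in [set delta : R |
    (lne (covering_number dist E delta) * ((- ln delta)^-1)%:E <= (s + e)%:E)%E]])).
  by apply: ereal_inf_lbound; exists [set delta : R |
    (lne (covering_number dist E delta) * ((- ln delta)^-1)%:E <= (s + e)%:E)%E].
by apply: ge_ereal_sup => _ [delta ? <-].
Unshelve. all: by end_near. Qed.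

Lemma upper_box_dim_set0 s : (upper_box_dim dist set0 <= s%:E)%E.
Proof.
apply: (@upper_box_dim_le _ 1) => //.
near=> delta; exists 0%N.
  have c : 'I_0 -> T by case.
  by exists c.
by rewrite mul1r expR_ge0.
Unshelve. all: by end_near. Qed.

Lemma covered_by_widen E delta n m (c0 : T) : (n <= m)%N ->
  Defs.covered_by dist E delta n -> Defs.covered_by dist E delta m.
Proof.
move=> nm [c cE]; exists (fun i => oapp c c0 (insub (val i))) => x /cE[i xi].
by exists (widen_ord nm i); rewrite /= valK.
Qed.

(** The cover is renumbered through [unpickle]; codes of no index receive the empty set, whose
    dimension lies below every real. *)
Lemma packing_dim_le_cover (I : countType) (P : I -> set T) E (c0 : T) s :
  E `<=` \bigcup_i P i -> (forall i, dist_bounded dist (P i)) ->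
  (forall i, (upper_box_dim dist (P i) <= s%:E)%E) ->
  (packing_dim dist E <= s%:E)%E.
Proof.
move=> EP bP dP.
pose F n := if unpickle n is Some i then P i else set0.
apply: (@le_trans _ _ (ereal_sup [set upper_box_dim dist (F i) | i in [set: nat]])).
  apply: ereal_inf_lbound; exists F => //; split.
    by move=> n; rewrite /F; case: unpickle => [i|]; [exact: bP|by exists c0, 0].
  by move=> x /EP[i _ Pix]; exists (pickle i) => //; rewrite /F pickleK.
apply: ge_ereal_sup => _ [n _ <-]; rewrite /F.
by case: unpickle => [i|]; [exact: dP|exact: upper_box_dim_set0].
Qed.

Lemma packing_dim_lt_cover E s : (packing_dim dist E < s%:E)%E ->
  exists F : nat -> set T, E `<=` \bigcup_i F i /\
    forall i, \forall delta \near (0 : R)^'+,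
      exists2 n, Defs.covered_by dist (F i) delta n & n%:R <= expR (s * - ln delta).
Proof.
move=> /ereal_inf_lt[_ [F [_ EF] <-]] supF; exists F; split => // i.
apply: upper_box_dim_lt; apply: le_lt_trans supF.
by apply: ereal_sup_ubound; exists i.
Qed.

Lemma le_packing_dim E F : E `<=` F ->
  (packing_dim dist E <= packing_dim dist F)%E.
Proof.
move=> EF; apply: ereal_inf_le_tmp => _ [G [bG FG] <-].
by exists G => //; split => //; exact: subset_trans FG.
Qed.

End BoxDim.

(** The interval [[-i, i]] is covered by a grid of mesh [delta] with at most [2 * i / delta + 1]
    points. This uniform bound later excludes an infinite packing dimension of [E]. *)
Lemma packing_dim_line_le1 (R : realType) (A : set R) :
  (packing_dim (@real_dist R) A <= 1%:E)%E.
Proof.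
pose P (i : nat) : set R := [set x | `|x| <= i%:R].
apply: (@packing_dim_le_cover _ _ _ _ P _ 0) => [x _|i|i].
- exists (Num.trunc `|x|).+1 => //; rewrite /P /=; exact/ltW/truncnS_gt.
- by exists 0, i%:R => x; rewrite /P /real_dist /= subr0.
- apply: (@upper_box_dim_le _ _ _ _ (2 * i%:R + 1)).
    by rewrite ltr_wpDl // mulr_ge0.
  near=> delta.
  have d0 : 0 < delta by near: delta; exact: nbhs_right_gt.
  have d1 : delta <= 1 by near: delta; exact: nbhs_right_le.
  set n := (Num.trunc (2 * i%:R / delta)).+1.
  have t0 : 0 <= 2 * i%:R / delta by rewrite divr_ge0 ?mulr_ge0 // ltW.
  exists n.
    exists (fun k : 'I_n => - i%:R + k%:R * delta) => x.
    rewrite /P /= ler_norml => /andP[xl xu].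
    have y0 : 0 <= (x + i%:R) / delta.
      by rewrite divr_ge0 ?(ltW d0) // -lerBlDr sub0r.
    (* The chosen centre is the last grid point to the left of [x]. *)
    have kn : (Num.trunc ((x + i%:R) / delta) < n)%N.
      rewrite ltnS le_truncn // ler_pM2r ?invr_gt0 //.
      by rewrite mulr_natl mulr2n lerD2r.
    exists (Ordinal kn); rewrite /real_dist /=.
    have /andP[] := truncn_itv y0.
    rewrite ler_pdivlMr // ltr_pdivrMr // => h1.
    rewrite -natr1 mulrDl mul1r => h2.
    by rewrite ler_norml; apply/andP; split; lra.
  rewrite /n mul1r expRN lnK ?posrE // -natr1.
  rewrite [leRHS]mulrDl mul1r lerD //; first by rewrite truncn_le.
  by rewrite invf_ge1.
Unshelve. all: by end_near. Qed.

(** * From pinned distances to the packing dimension *)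

Lemma rV_norm_entry_le (R : realType) (d : nat) (x : 'rV[R]_d) i :
  `|x 0 i| <= `|x|.
Proof.
rewrite {2}/Num.norm/= mx_normrE.
exact: (@le_bigmax _ _ _ 0 (fun ij => `|x ij.1 ij.2|) (0, i)).
Qed.

Lemma rV_norm_lt (R : realType) (d : nat) (x : 'rV[R]_d) (e : R) :
  0 < e -> (forall i, `|x 0 i| < e) -> `|x| < e.
Proof.
move=> e0 xe; rewrite /Num.norm/= mx_normrE; apply: bigmax_lt => // -[i j] _ /=.
by rewrite ord1.
Qed.

Lemma near_right0_div (R : realType) (K : R) (P : set R) : 0 < K ->
  (\forall delta \near (0 : R)^'+, P delta) ->
  \forall delta \near (0 : R)^'+, P (delta / K).
Proof.
move=> K0 /nbhs_ballP[e /= e0 He]; near=> delta.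
have d0 : 0 < delta by near: delta; exact: nbhs_right_gt.
apply: He => /=; last by rewrite divr_gt0.
rewrite -ball_normE /= sub0r normrN gtr0_norm ?divr_gt0 // ltr_pdivrMr //.
by near: delta; apply: nbhs_right_lt; rewrite mulr_gt0.
Unshelve. all: by end_near. Qed.

Lemma euclidean_dist_le (R : realType) (d : nat) (x y : 'rV[R]_d) :
  euclidean_dist x y <= Num.sqrt d%:R * `|x - y|.
Proof.
rewrite /euclidean_dist -[X in _ * X]ger0_norm // -sqrtr_sqr -sqrtrM //.
rewrite ler_wsqrtr // /inner (@le_trans _ _ (\sum_(i < d) `|x - y| ^+ 2)) //.
  apply: ler_sum => i _; rewrite -expr2 -real_normK ?num_real //.
  by rewrite lerXn2r ?nnegrE // rV_norm_entry_le.
by rewrite sumr_const card_ord mulr_natl.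
Qed.

Lemma rat_approx (R : realType) (d : nat) (y : 'rV[R]_d) (e : R) : 0 < e ->
  exists q : 'rV[rat]_d, `|y - map_mx ratr q| < e.
Proof.
move=> e0.
have /choice[q Hq] : forall i, exists q : rat, `|y 0 i - ratr q| < e.
  move=> i; have [|q] := @rat_in_itvoo _ (y 0 i - e) (y 0 i + e).
    by rewrite ltrD2l gtrN.
  rewrite in_itv/= => /andP[q1 q2]; exists q.
  by rewrite ltr_norml; apply/andP; split; lra.
by exists (\row_i q i); apply: rV_norm_lt => // i; rewrite !mxE.
Qed.

(** On a piece with [d] pins, covering each pinned distance set by [n] intervals cuts the piece into
    [n ^ d] cells, whose diameters the Lipschitz bound controls. Rational balls and the countable
    type [S] of strata reduce the local hypothesis to countably many pieces. *)
Lemma packing_dim_le_pins (R : realType) (d : nat) (S : countType)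
    (N : 'rV[R]_d -> R) (E : set 'rV[R]_d) (st : 'rV[R]_d -> S) (s : R) :
  (forall y0, E y0 -> exists r c (x : 'I_d -> 'rV[R]_d),
     [/\ 0 < r, 0 <= c, forall i, E (x i) &
       forall y y', E y -> E y' -> st y = st y0 -> st y' = st y0 ->
         `|y - y0| < r -> `|y' - y0| < r ->
         `|y - y'| <= c * \sum_i `|N (y - x i) - N (y' - x i)|]) ->
  (forall x, E x ->
     (packing_dim (@real_dist R) (pinned_distance_set N E x) < s%:E)%E) ->
  (packing_dim (@euclidean_dist R d) E <= (d%:R * s)%:E)%E.
Proof.
move=> Hloc HE.
have /choice[F HF] : forall x, exists F : nat -> set R, E x ->
    pinned_distance_set N E x `<=` \bigcup_i F i /\
    forall i, \forall delta \near (0 : R)^'+,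
      exists2 n, Defs.covered_by (@real_dist R) (F i) delta n &
        n%:R <= expR (s * - ln delta).
  move=> x; have [Ex|nEx] := pselect (E x); last by exists (fun=> set0).
  by have [F ?] := packing_dim_lt_cover (HE x Ex); exists F.
(* Rational balls and strata give countably many candidate pieces; [p] picks
   pins and a Lipschitz constant for those which admit them. *)
pose J := ('rV[rat]_d * nat * S)%type.
pose piece (t : J) : set 'rV[R]_d := [set y | [/\ E y, st y = t.2 &
  `|y - map_mx ratr t.1.1| < t.1.2.+1%:R^-1]].
pose good (t : J) (p : R * ('I_d -> 'rV[R]_d)) := [/\ 0 <= p.1,
  forall i, E (p.2 i) & forall y y', piece t y -> piece t y' ->
    `|y - y'| <= p.1 * \sum_i `|N (y - p.2 i) - N (y' - p.2 i)|].
have /choice[p Hp] : forall t, exists p, (exists p', good t p') -> good t p.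
  move=> t; have [[p' ?]|n] := pselect (exists p', good t p'); first by exists p'.
  by exists (0, fun=> 0).
(* The second index records, for every pin, which member of the cover of its pinned distance set
   contains the distance. *)
pose P (k : J * {ffun 'I_d -> nat}) : set 'rV[R]_d := [set y | [/\ piece k.1 y,
  good k.1 (p k.1) & forall i, F ((p k.1).2 i) (k.2 i) (N (y - (p k.1).2 i))]].
apply: (@packing_dim_le_cover _ _ _ _ P _ 0).
- move=> y0 Ey0; have [r [c [x [r0 c0 Ex Hx]]]] := Hloc _ Ey0.
  (* The radius [n.+1%:R^-1] is below [r / 2], so a ball of this radius that contains [y0] stays
     within [r] of [y0]. *)
  pose n := Num.trunc (2 / r).
  have n0 : 0 < n.+1%:R^-1 :> R by rewrite invr_gt0.
  have nr : n.+1%:R^-1 * 2 < r.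
    by rewrite mulrC ltr_pdivrMr // mulrC -ltr_pdivrMr // truncnS_gt.
  have [q Hq] := rat_approx y0 n0.
  pose t : J := (q, n, st y0).
  have gt : good t (p t).
    apply: Hp; exists (c, x); split => //= y y' [Ey sy yq] [Ey' sy' y'q].
    have near_y0 z : `|z - map_mx ratr q| < n.+1%:R^-1 -> `|z - y0| < r.
      move=> zq; rewrite (le_lt_trans (ler_distD (map_mx ratr q) _ _)) //.
      by rewrite (le_lt_trans _ nr) // mulr_natr mulr2n lerD // ltW // distrC.
    by apply: Hx => //; exact: near_y0.
  have /choice[m Hm] : forall i, exists m, F ((p t).2 i) m (N (y0 - (p t).2 i)).
    move=> i; have [_ Ei _] := gt; have [cov _] := HF _ (Ei i).
    by have [|m _ ?] := cov (N (y0 - (p t).2 i)); [exists y0|exists m].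
  by exists (t, finfun m) => //; split => // i; rewrite ffunE.
- move=> [t m]; exists (map_mx ratr t.1.1), (Num.sqrt d%:R * t.1.2.+1%:R^-1).
  move=> y [[_ _ yq] _ _].
  by rewrite (le_trans (euclidean_dist_le _ _)) // ler_wpM2l // ltW.
move=> [t m]; have [->|/set0P[y1 Py1]] := eqVneq (P (t, m)) set0.
  exact: upper_box_dim_set0.
have [_ [/= c0 Ex Hc] _] := Py1.
set c := (p t).1 in c0 Hc; set x := (p t).2 in Ex Hc.
(* Within a cell each of the [d] distances varies by at most [2 * delta'], so the Euclidean diameter
   is at most [(K - 1) * delta']; the summand 1 keeps [K] positive even if [c] is 0. *)
pose K : R := Num.sqrt d%:R * (c * (d%:R * 2)) + 1.
have K0 : 0 < K by rewrite ltr_wpDl // !mulr_ge0.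
apply: (@upper_box_dim_le _ _ _ _ (expR (d%:R * s * ln K))); first exact: expR_gt0.
have Hnear : \forall delta \near (0 : R)^'+, forall i : 'I_d,
    exists2 n, Defs.covered_by (@real_dist R) (F (x i) (m i)) delta n &
      n%:R <= expR (s * - ln delta).
  by apply: filter_forall => i; have [_] := HF _ (Ex i); exact.
apply: filterS2 (near_right0_div K0 Hnear) (nbhs_right_gt 0) => delta.
set delta' := delta / K => Hdelta d0.
(* One number of centres serves all pins, so that cells are indexed by functions from ['I_d] to
   ['I_n]. *)
pose n := Num.trunc (expR (s * - ln delta')).
have /choice[c' Hc'] : forall i, exists c' : 'I_n -> R,
    forall a, F (x i) (m i) a -> exists k, real_dist a (c' k) <= delta'.
  move=> i; have [n' cov n'le] := Hdelta i.
  by apply: (covered_by_widen 0 _ cov); rewrite truncn_ge_nat // expR_ge0.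
pose cell (k : {ffun 'I_d -> 'I_n}) : set 'rV[R]_d :=
  [set y | P (t, m) y /\ forall i, real_dist (N (y - x i)) (c' i (k i)) <= delta'].
(* Each nonempty cell is covered by a ball centred at one of its own points; empty cells get a dummy
   centre. *)
have /choice[pt Hpt] : forall k, exists y, cell k !=set0 -> cell k y.
  move=> k; have [[y ?]|no] := pselect (cell k !=set0); first by exists y.
  by exists 0.
exists #|{ffun 'I_d -> 'I_n}|.
  exists (fun j => pt (enum_val j)) => y Py; have [piecey _ Fy] := Py.
  have /choice[k Hk] : forall i, exists k, real_dist (N (y - x i)) (c' i k) <= delta'.
    by move=> i; apply: Hc'; exact: Fy.
  exists (enum_rank (finfun k)); rewrite enum_rankK.
  have [] : cell (finfun k) (pt (finfun k)).
    by apply: Hpt; exists y; split => // i; rewrite ffunE.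
  move=> [piecez _ _] Hz; set z := pt _ in piecez Hz *.
  rewrite (le_trans (euclidean_dist_le _ _)) //.
  apply: (@le_trans _ _ ((K - 1) * delta')); last first.
    rewrite -[leRHS](@mulfVK _ K) ?gt_eqF // mulrC ler_pM2l ?divr_gt0 //.
    by rewrite gerBl.
  rewrite /K addrK -mulrA ler_wpM2l // -mulrA.
  rewrite (le_trans (Hc _ _ piecey piecez)) // ler_wpM2l //.
  apply: (@le_trans _ _ (\sum_(i < d) (2 * delta'))); last first.
    by rewrite sumr_const card_ord -[leLHS]mulr_natl mulrA.
  apply: ler_sum => i _; rewrite (le_trans (ler_distD (c' i (k i)) _ _)) //.
  rewrite mulr_natl mulr2n lerD // ?Hk //.
  by have := Hz i; rewrite ffunE /real_dist distrC.
rewrite card_ffun !card_ord natrX.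
rewrite (@le_trans _ _ (expR (s * - ln delta') ^+ d)) //.
  by rewrite lerXn2r ?nnegrE ?expR_ge0 // truncn_le expR_ge0.
(* Replacing [delta'] by [delta / K] costs exactly the factor [expR (d%:R * s * ln K)]. *)
rewrite -expRM_natl -expRD ler_expR /delta' ln_div ?posrE //.
by rewrite le_eqVlt; apply/orP; left; apply/eqP; ring.
Qed.

(** * Norms *)

Lemma near_dist_lt (R : realType) (V : normedModType R) (x : V) (e : R) :
  0 < e -> \forall y \near x, `|x - y| < e.
Proof. by move=> e0; exact: (cvgrPdist_lt _ _).1 (@cvg_id _ (nbhs x)) e e0. Qed.

Section NormTheory.
Context (R : realType) (d : nat) (N : 'rV[R]_d -> R) (hN : is_norm N).
Implicit Types x y z u : 'rV[R]_d.

Let N_ge0 x : 0 <= N x. Proof. by case: hN. Qed.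
Let N_eq0 x : N x = 0 -> x = 0. Proof. by case: hN => _ + _ _; apply. Qed.
Let N_scale (a : R) x : N (a *: x) = `|a| * N x. Proof. by case: hN. Qed.
Let N_triangle x y : N (x + y) <= N x + N y. Proof. by case: hN. Qed.

Lemma is_norm0 : N 0 = 0.
Proof. by rewrite -(scale0r 0) N_scale normr0 mul0r. Qed.

Lemma is_normN x : N (- x) = N x.
Proof. by rewrite -scaleN1r N_scale normrN1 mul1r. Qed.

Lemma is_norm_gt0 x : x != 0 -> 0 < N x.
Proof.
by move=> x0; rewrite lt_neqAle N_ge0 andbT eq_sym; apply: contra_neq x0 => /N_eq0.
Qed.

Lemma is_norm_le : exists2 C : R, 0 < C & forall x, N x <= C * `|x|.
Proof.
exists (\sum_i N (delta_mx 0 i) + 1); first by rewrite ltr_wpDl // sumr_ge0.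
move=> x; rewrite {1}(row_sum_delta x).
have Nsum (r : seq 'I_d) (F : 'I_d -> 'rV[R]_d) :
    N (\sum_(i <- r) F i) <= \sum_(i <- r) N (F i).
  elim: r => [|i r IHr]; first by rewrite !big_nil is_norm0.
  by rewrite !big_cons (le_trans (N_triangle _ _)) // lerD2l.
rewrite (le_trans (Nsum _ _)) // mulrDl mul1r ler_wpDr // mulr_suml.
apply: ler_sum => i _; rewrite N_scale mulrC ler_wpM2l //.
exact: rV_norm_entry_le.
Qed.

Lemma is_norm_dist x y : `|N x - N y| <= N (x - y).
Proof.
have N_sub u v : N u - N v <= N (u - v).
  by rewrite lerBlDr -{1}(subrK v u).
rewrite ler_norml N_sub andbT lerNl opprB.
by rewrite -(is_normN (x - y)) opprB.
Qed.

Lemma is_norm_continuous : continuous N.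
Proof.
have [C C0 NC] := is_norm_le.
move=> x; apply/(@cvgrPdist_lt _ _ _ (nbhs x) _) => e e0.
apply: filterS (near_dist_lt x (divr_gt0 e0 C0)) => y xy.
rewrite (le_lt_trans (is_norm_dist _ _)) // (le_lt_trans (NC _)) //.
by rewrite mulrC -ltr_pdivlMr.
Qed.

Lemma compact_unit_sphere : compact [set w : 'rV[R]_d | `|w| = 1].
Proof.
apply: bounded_closed_compact.
  by exists 1; split => // M M1 w /= ->; exact: ltW.
have -> : [set w : 'rV[R]_d | `|w| = 1] = (@Num.norm _ _) @^-1` [set 1] by [].
apply: closed_comp => [x _|]; first exact: norm_continuous.
exact: closed_eq.
Qed.

(** On the compact unit sphere [N] is continuous and positive. The local bounds [N w / 2] therefore
    combine into a uniform one, which homogeneity extends to all vectors. *)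
Lemma is_norm_ge : exists2 c : R, 0 < c & forall x, c * `|x| <= N x.
Proof.
have : \forall c \near (0 : R)^'+, [set w : 'rV[R]_d | `|w| = 1] `<=`
    [set w | c <= N w].
  apply: (compact_near_coveringP _).1 compact_unit_sphere _ _ _ _ _ => w /= w1.
  have Nw : 0 < N w by rewrite is_norm_gt0 // -normr_gt0 w1.
  have Nw' : \forall w' \near w, N w / 2 < N w'.
    apply: (cvgr_gt (N w) (@is_norm_continuous w)).
    by rewrite ltr_pdivrMr // mulr_natr mulr2n ltrDl.
  near=> w' c => /=; rewrite (@le_trans _ _ (N w / 2)) //.
    by near: c; apply: nbhs_right_le; rewrite divr_gt0.
  by apply: ltW; near: w'.
move=> H; near (0 : R)^'+ => c.
have c0 : 0 < c by near: c; exact: nbhs_right_gt.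
have Hc : [set w : 'rV[R]_d | `|w| = 1] `<=` [set w | c <= N w] by near: c.
exists c => // x; have [->|x0] := eqVneq x 0; first by rewrite normr0 mulr0.
have nx : 0 < `|x| by rewrite normr_gt0.
have := Hc (`|x|^-1 *: x); rewrite /= N_scale normrZ normfV normr_id.
by rewrite mulVf ?gt_eqF // ler_pdivlMl // mulrC; exact.
Unshelve. all: by end_near. Qed.

Lemma is_norm_diff_cvg z u : differentiable N z ->
  h^-1 * (N (z + h *: u) - N z) @[h --> (0 : R)^'+] --> 'd N z u.
Proof.
move=> dN; rewrite -deriveE //; apply: cvg_dnbhs_at_right.
have /cvg_ex[l Hl] : derivable N z u by exact: diff_derivable.
have -> : 'D_u N z = l by exact: (cvg_lim (@norm_hausdorff _ _) Hl).
have <- : (fun h : R => h^-1 *: ((N \o shift z) (h *: u) - N z)) =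
  (fun h => h^-1 * (N (z + h *: u) - N z)).
  by apply/funext => h /=; rewrite [z + _]addrC.
exact: Hl.
Qed.

(** Convexity: for [0 < h <= 1] the difference quotient with step [h] is at most the one with step
    1. Thus the differential is a subgradient. *)
Lemma is_norm_diff_le z u : differentiable N z -> 'd N z u <= N (z + u) - N z.
Proof.
move=> dN; apply: (cvgr_to_le (@is_norm_diff_cvg z u dN)); near=> h.
have h0 : 0 < h by near: h; exact: nbhs_right_gt.
have h1 : h <= 1 by near: h; exact: nbhs_right_le.
rewrite ler_pdivrMl // mulrBr -subr_ge0.
have -> : z + h *: u = h *: (z + u) + (1 - h) *: z.
  by rewrite scalerDr scalerBl scale1r [h *: z + _]addrC -addrA [_ + (z - _)]addrC
       subrK addrC.
have := N_triangle (h *: (z + u)) ((1 - h) *: z).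
rewrite !N_scale (gtr0_norm h0) ger0_norm ?subr_ge0 // mulrBl mul1r => H.
lra.
Unshelve. all: by end_near. Qed.

(** A subgradient lies below every difference quotient with positive step, hence below their
    limit. *)
Lemma is_norm_diff_ge z (f : {linear 'rV[R]_d -> R}) u : differentiable N z ->
  (forall u, f u <= N (z + u) - N z) -> f u <= 'd N z u.
Proof.
move=> dN Hf; apply: (cvgr_to_ge (@is_norm_diff_cvg z u dN)); near=> h.
have h0 : 0 < h by near: h; exact: nbhs_right_gt.
by rewrite ler_pdivlMl // -[_ * f u]linearZ Hf.
Unshelve. all: by end_near. Qed.

(** Euler's identity for a homogeneous function, from the subgradient inequality in the directions
    [z] and [- z]. *)
Lemma is_norm_diff_self z : differentiable N z -> 'd N z z = N z.
Proof.
move=> dN; apply/eqP; rewrite eq_le; apply/andP; split.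
  have := @is_norm_diff_le z z dN.
  by rewrite -mulr2n -scaler_nat N_scale normr_nat mulr_natl mulr2n addrK.
have := @is_norm_diff_le z (- z) dN.
by rewrite linearN subrr is_norm0 sub0r lerN2.
Qed.

Lemma linear_le_eq (f g : {linear 'rV[R]_d -> R}) u :
  (forall v, f v <= g v) -> f u = g u.
Proof.
by move=> fg; apply: le_anti; rewrite fg -lerN2 -2!linearN fg.
Qed.

(* Both differentials are subgradients of [N] at [z], and a subgradient at a
   point of differentiability is unique. *)
Lemma is_norm_diff_scale (t : R) z u : 0 < t ->
  differentiable N z -> differentiable N (t *: z) -> 'd N (t *: z) u = 'd N z u.
Proof.
move=> t0 dz dtz; apply: linear_le_eq => v.
apply: (@is_norm_diff_ge z ('d N (t *: z)) v dz) => w.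
have := @is_norm_diff_le (t *: z) (t *: w) dtz.
rewrite linearZ /= -scalerDr !N_scale.
by rewrite gtr0_norm // -mulrBr ler_pM2l.
Qed.

End NormTheory.

(** * C1 norms *)

Lemma innerDl (R : realType) (d : nat) (x y z : 'rV[R]_d) :
  inner (x + y) z = inner x z + inner y z.
Proof.
by rewrite -big_split; apply: eq_bigr => i _; rewrite mxE mulrDl.
Qed.

Lemma innerZl (R : realType) (d : nat) (a : R) (x y : 'rV[R]_d) :
  inner (a *: x) y = a * inner x y.
Proof.
by rewrite mulr_sumr; apply: eq_bigr => i _; rewrite mxE mulrA.
Qed.

Lemma innerNl (R : realType) (d : nat) (x y : 'rV[R]_d) :
  inner (- x) y = - inner x y.
Proof. by rewrite -scaleN1r innerZl mulN1r. Qed.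

Lemma cvg_inner (R : realType) (d : nat) (T : Type) (F : set_system T)
    (FF : Filter F) (f g : T -> 'rV[R]_d) (a b : 'rV[R]_d) :
  (forall i, f t 0 i @[t --> F] --> a 0 i) ->
  (forall i, g t 0 i @[t --> F] --> b 0 i) ->
  inner (f t) (g t) @[t --> F] --> inner a b.
Proof.
move=> fa gb; rewrite /inner.
by apply: cvg_big => [|i _]; [exact: add_continuous|exact: cvgM].
Qed.

Lemma cvg_det (R : realType) (n : nat) (T : Type) (F : set_system T)
    (FF : Filter F) (A : T -> 'M[R]_n) (A0 : 'M[R]_n) :
  (forall i j, A t i j @[t --> F] --> A0 i j) ->
  \det (A t) @[t --> F] --> \det A0.
Proof.
move=> AA0; rewrite /determinant.
apply: cvg_big => [|s _]; first exact: add_continuous.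
apply: cvgM; first exact: cvg_cst.
by apply: cvg_big => [|i _]; [exact: mul_continuous|exact: AA0].
Qed.

(* A full row rank is certified by a right inverse [B] of [A0]: [det (A t *m B)]
   stays nonzero. *)
Lemma row_free_near (R : realType) (m n : nat) (T : Type) (F : set_system T)
    (FF : Filter F) (A : T -> 'M[R]_(m, n)) (A0 : 'M[R]_(m, n)) :
  (forall i j, A t i j @[t --> F] --> A0 i j) -> row_free A0 ->
  \forall t \near F, row_free (A t).
Proof.
move=> AA0 /row_freeP[B A0B].
have detB : \det (A t *m B) @[t --> F] --> (1 : R).
  rewrite -(det1 R m) -A0B; apply: cvg_det => i j.
  rewrite mxE; under eq_fun do rewrite mxE.
  apply: cvg_big => [|k _]; first exact: add_continuous.
  by apply: cvgM => //; exact: cvg_cst.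
have : \forall t \near F, 0 < \det (A t *m B) by exact: (cvgr_gt _ detB).
apply: filterS => t /gt_eqF/negbT.
rewrite -unitfE -[_ \is a GRing.unit]/(A t *m B \in unitmx) => u.
by apply/row_freeP; exists (B *m invmx (A t *m B)); rewrite mulmxA mulmxV.
Qed.

(** The missing pins are copies of [x0]; they only add nonnegative terms to the sum. *)
Lemma pad_pins (R : realType) (T : Type) (k d : nat) (x : 'I_k -> T) (x0 : T) :
  (k <= d)%N -> exists x' : 'I_d -> T,
    (forall E : set T, E x0 -> (forall i, E (x i)) -> forall i, E (x' i)) /\
    forall a : T -> R, (forall y, 0 <= a y) ->
      \sum_i a (x i) <= \sum_i a (x' i).
Proof.
move=> kd; pose X n := oapp x x0 (insub n : option 'I_k).
exists (fun i => X i); split=> [E Ex0 Ex i|a a0].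
  by rewrite /X; case: insub => [j|] /=.
have -> : \sum_i a (x i) = \sum_(i < k) a (X i).
  by apply: eq_bigr => i _; rewrite /X valK.
rewrite (big_ord_widen _ (fun i => a (X i)) kd) big_mkcond /=.
by apply: ler_sum => i _; case: ifP.
Qed.

Lemma eq_fun_continuous_at (T U : topologicalType) (f g : T -> U) (z : T) :
  f =1 g -> {for z, continuous g} -> {for z, continuous f}.
Proof. by move=> /funext ->. Qed.

(* The gradient is kept abstract because unification diverges when it unfolds
   the differential ['d N]. *)
Record is_gradient (R : realType) (d : nat) (N : 'rV[R]_d -> R)
    (G : 'rV[R]_d -> 'rV[R]_d) : Prop := IsGradient {
  gradient_continuous : forall z j, z != 0 -> {for z, continuous (fun y => G y 0 j)};
  gradient_le : forall z u, z != 0 -> inner u (G z) <= N (z + u) - N z;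
  gradient_self : forall z, z != 0 -> inner z (G z) = N z;
  gradient_scale : forall (t : R) z, 0 < t -> z != 0 -> G (t *: z) = G z }.

Lemma linear_inner (R : realType) (d : nat) (f : {linear 'rV[R]_d -> R}) v :
  f v = inner v (\row_j f (delta_mx 0 j)).
Proof.
rewrite {1}(row_sum_delta v) linear_sum; apply: eq_bigr => j _.
by rewrite linearZ mxE.
Qed.

Lemma C1_norm_gradient (R : realType) (d : nat) (N : 'rV[R]_d -> R) :
  is_norm N -> C1_away_from_0 N -> exists G, is_gradient N G.
Proof.
move=> hN hC; exists (fun z => \row_j 'd N z (delta_mx 0 j)).
split=> [z j z0|z u z0|z z0|t z t0 z0].
- apply: (eq_fun_continuous_at (g := fun y => 'd N y (delta_mx 0 j))).
    by move=> y; rewrite mxE.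
  exact: (hC z z0).2.
- by rewrite -linear_inner; exact: (is_norm_diff_le hN u (hC z z0).1).
- by rewrite -linear_inner; exact: (is_norm_diff_self hN (hC z z0).1).
- apply/rowP => j; rewrite [LHS]mxE [RHS]mxE.
  apply: (is_norm_diff_scale hN) => //; first exact: (hC z z0).1.
  by apply: (hC _ _).1; rewrite scaler_eq0 negb_or gt_eqF.
Qed.

Section C1Norm.
Context (R : realType) (d : nat) (N : 'rV[R]_d -> R) (G : 'rV[R]_d -> 'rV[R]_d).
Context (hN : is_norm N) (hG : is_gradient N G).
Implicit Types (x y z u w : 'rV[R]_d) (E : set 'rV[R]_d).

Definition free_pins E y m := exists x : 'I_m -> 'rV[R]_d,
  (forall i, E (x i) /\ x i != y) /\ row_free (\matrix_(i < m) G (y - x i)).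

(** At most [d] gradients are independent, so the range [d.+1] covers all sizes. *)
Definition pin_rank E y : nat := \max_(m < d.+1 | `[<free_pins E y m>]) m.

Lemma free_pins_le E y m : free_pins E y m -> (m <= pin_rank E y)%N.
Proof.
move=> pm; have [x [_ /eqP rk]] := pm.
have md : (m < d.+1)%N by rewrite ltnS -[m]rk rank_leq_col.
by apply: (@leq_bigmax_cond _ _ _ (Ordinal md)); exact/asboolP.
Qed.

(** The maximum is attained because the empty family of pins is always free. *)
Lemma free_pins_rank E y : free_pins E y (pin_rank E y).
Proof.
have free0 : free_pins E y 0.
  exists (fun=> 0); split; first by case.
  by rewrite /row_free eqn_leq rank_leq_row.
have [|m] := @eq_bigmax_cond _ [pred m : 'I_d.+1 | `[<free_pins E y m>]]
    (fun m => m : nat).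
  by apply/card_gt0P; exists ord0; rewrite inE.
by rewrite inE => pm e; have -> : pin_rank E y = m :> nat by exact: e.
Qed.

(** Pairing a linear relation with [w] kills every row but [G w], which gives [N w > 0]. So the
    coefficient of [G w] vanishes, and the other rows are independent. *)
Lemma free_pins_extend y0 k (x : 'I_k -> 'rV[R]_d) w : w != 0 ->
  row_free (\matrix_(i < k) G (y0 - x i)) ->
  (forall i, inner w (G (y0 - x i)) = 0) ->
  row_free (col_mx (G w) (\matrix_(i < k) G (y0 - x i))).
Proof.
move=> w0 Gfree Gw; set M := \matrix_(i < k) _ in Gfree *.
rewrite -kermx_eq0; apply/rowV0P => u /sub_kermxP.
rewrite -[u]hsubmxK mul_row_col; set a := lsubmx u; set b := rsubmx u => uG.
have Mw0 : M *m w^T = 0.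
  apply/colP => i; rewrite !mxE -[RHS](Gw i).
  by apply: eq_bigr => j _; rewrite !mxE mulrC.
have dw : G w *m w^T = (N w)%:M.
  rewrite [LHS]mx11_scalar; congr _%:M.
  rewrite -(gradient_self hG w0) mxE.
  by apply: eq_bigr => j _; rewrite mxE mulrC.
have a0 : a = 0.
  have := congr1 (mulmx^~ w^T) uG; rewrite /= mulmxDl -!mulmxA.
  rewrite Mw0 dw mulmx0 addr0 mul0mx.
  rewrite mul_mx_scalar => /eqP; rewrite scaler_eq0 gt_eqF ?is_norm_gt0 //=.
  by move/eqP.
move: uG; rewrite a0 mul0mx add0r => bG.
have b0 : b = 0 by apply: (row_free_inj Gfree); rewrite mul0mx.
by rewrite b0 row_mx0.
Qed.

Lemma C1_norm_pins E y0 : E y0 -> exists r c (x : 'I_d -> 'rV[R]_d),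
  [/\ 0 < r, 0 <= c, forall i, E (x i) &
    forall y y', E y -> E y' -> pin_rank E y = pin_rank E y0 ->
      pin_rank E y' = pin_rank E y0 -> `|y - y0| < r -> `|y' - y0| < r ->
      `|y - y'| <= c * \sum_i `|N (y - x i) - N (y' - x i)|].
Proof.
move=> Ey0; set k := pin_rank E y0.
have [x [Hx Gfree]] := free_pins_rank E y0; rewrite -/k in x Hx Gfree.
have z0 i : y0 - x i != 0 by rewrite subr_eq0 eq_sym (Hx i).2.
have kd : (k <= d)%N by rewrite -[k](eqP Gfree) rank_leq_col.
have nz i : nbhs y0 [set y | y - x i != 0].
  have := z0 i; rewrite -normr_gt0 => /(near_dist_lt y0).
  apply: filterS => y; apply: contraTneq => /eqP; rewrite subr_eq0 => /eqP ->.
  by rewrite ltxx.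
have cvg_shift i j : G (y - x i) 0 j @[y --> y0] --> G (y0 - x i) 0 j.
  apply: (@cvg_comp _ _ _ (fun y => y - x i) (fun y => G y 0 j)
      (nbhs y0) (nbhs (y0 - x i)));
    last exact: (gradient_continuous hG (z0 i)).
  by apply: cvgB; [exact: cvg_id|exact: cvg_cst].
(* The Lipschitz bound for pairs of direction [w], with the constant inverted. It is proved near
   each unit [w] for [y], [y'] near [y0] and small [c > 0]; compactness of the sphere then gives
   uniformity in [w]. *)
pose Q w y y' c := E y -> pin_rank E y = k -> E y' -> y != y' ->
  y - y' = `|y - y'| *: w ->
  c * `|y - y'| <= \sum_i `|N (y - x i) - N (y' - x i)|.
have Hnear : \forall p \near filter_prod (filter_prod (nbhs y0) (nbhs y0)) (0 : R)^'+,
    [set w : 'rV[R]_d | `|w| = 1] `<=` [set w | Q w p.1.1 p.1.2 p.2].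
  have /compact_near_coveringP cov := @compact_unit_sphere R d.
  apply: (cov _ _ (fun p w => Q w p.1.1 p.1.2 p.2)).
  suff Hw (w : 'rV[R]_d) : `|w| = 1 -> \forall w' \near w &
      p \near filter_prod (filter_prod (nbhs y0) (nbhs y0)) (0 : R)^'+,
      Q w' p.1.1 p.1.2 p.2 by exact: Hw.
  move=> w1.
  have w0 : w != 0 by rewrite -normr_gt0 w1.
  have intro (A : set ('rV[R]_d * 'rV[R]_d)) (C : set R) :
      (\forall p \near filter_prod (nbhs y0) (nbhs w), A p) -> (0 : R)^'+ C ->
      (forall w' y y' c, A (y, w') -> A (y', w') -> C c -> Q w' y y' c) ->
      \forall w' \near w &
        p \near filter_prod (filter_prod (nbhs y0) (nbhs y0)) (0 : R)^'+,
        Q w' p.1.1 p.1.2 p.2.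
    move=> [[A1 B1] /= [nA nB] AB] nC HQ.
    exists (B1, (A1 `*` A1) `*` C) => /=.
      by split => //; exists (A1 `*` A1, C) => //=; split => //; exists (A1, A1).
    move=> [w' [[y y'] c]] /= [Bw' [[Ay Ay'] Cc]].
    by apply: HQ => //; apply: AB.
  have cvg1 (f : 'rV[R]_d -> R) (l : R) : f y @[y --> y0] --> l ->
      f p.1 @[p --> filter_prod (nbhs y0) (nbhs w)] --> l.
    by move=> fl A /fl; exact: (@cvg_fst _ _ (nbhs y0) (nbhs w)).
  have cvg2 (f : 'rV[R]_d -> R) (l : R) : f y @[y --> w] --> l ->
      f p.2 @[p --> filter_prod (nbhs y0) (nbhs w)] --> l.
    by move=> fl A /fl; exact: (@cvg_snd _ _ (nbhs y0) (nbhs w)).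
  (* If some gradient at [y0] does not vanish on [w], its pin alone gives the bound: near [(y0, w)]
     the pairing differs from [b] by less than half of [|b|]. *)
  have [[i wi]|nowi] := pselect (exists i, inner w (G (y0 - x i)) != 0).
    pose b := inner w (G (y0 - x i)); rewrite -/b in wi.
    have b0 : 0 < `|b| / 2 by rewrite divr_gt0 // normr_gt0.
    have cvg_b : inner p.2 (G (p.1 - x i))
        @[p --> filter_prod (nbhs y0) (nbhs w)] --> b.
      apply: (@cvg_inner _ _ _ (filter_prod (nbhs y0) (nbhs w)) _
        snd (fun p => G (p.1 - x i))) => j.
        apply: (cvg2 (fun v : 'rV[R]_d => v 0 j) (w 0 j)); exact: coord_continuous.
      exact: (cvg1 (fun y => G (y - x _) 0 j) _ (cvg_shift _ j)).
    apply: (intro [set p | `|b - inner p.2 (G (p.1 - x i))| < `|b| / 2 /\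
        p.1 - x i != 0] [set c | c <= `|b| / 2]).
    - apply: filterI; first exact: (cvgrPdist_lt _ _).1 cvg_b _ b0.
      exact: (cvg_fst (nz i)).
    - exact: nbhs_right_le.
    move=> w' y y' c [/= h nyx] [/= h' ny'x] /= cb _ _ _ _ yw'.
    set t := `|y - y'| in yw' *; have t0 : 0 <= t := normr_ge0 _.
    rewrite (@le_trans _ _ (`|N (y - x i) - N (y' - x i)|)) //; last first.
      by rewrite (bigD1 i) //= ler_wpDr // sumr_ge0.
    have yE : y - x i = (y' - x i) + t *: w' by rewrite -yw' [RHS]addrC subrKA.
    have y'E : y' - x i = (y - x i) + - (t *: w') by rewrite yE addrK.
    (* The subgradient inequalities at both endpoints replace the mean value theorem: the difference
       of the distances lies between [t] times the pairing at [y'] and [t] times the pairing at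
       [y]. *)
    have := gradient_le hG (t *: w') ny'x.
    have := gradient_le hG (- (t *: w')) nyx.
    rewrite -yE -y'E innerNl !innerZl.
    move: h h'; set g := inner w' _; set g' := inner w' _ => h h' H H'.
    have ct : c * t <= t * (`|b| / 2) by rewrite mulrC ler_wpM2l.
    rewrite (le_trans ct) // ler_normr.
    have [bpos|bneg] := leP 0 b.
      apply/orP; left; apply: le_trans H'; rewrite ler_wpM2l //.
      move: h'; rewrite (ger0_norm bpos) ltr_distl => /andP[h1 h2]; lra.
    apply/orP; right; rewrite opprB; apply: le_trans H; rewrite -mulrN ler_wpM2l //.
    move: h; rewrite (ltr0_norm bneg) ltr_distl => /andP[h1 h2]; lra.
  (* Otherwise [G w] is independent of the [k] gradients, and remains so for nearby points and
     directions; [Q] then holds because its premises are contradictory. *)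
  have Gw i : inner w (G (y0 - x i)) = 0.
    by apply/eqP; apply/negP => /negP wi; apply: nowi; exists i.
  have free := free_pins_extend w0 Gfree Gw.
  pose A (p : 'rV[R]_d * 'rV[R]_d) :=
    col_mx (G p.2) (\matrix_(i < k) G (p.1 - x i)).
  apply: (intro [set p | row_free (A p) /\ forall i, p.1 - x i != 0]
                [set c | 0 < c]).
  - apply: filterI; last first.
      have : \forall p \near filter_prod (nbhs y0) (nbhs w), forall i, p.1 - x i != 0.
        by apply: filter_forall => i; exact: (cvg_fst (nz i)).
      exact.
    apply: (@row_free_near _ _ _ _ (filter_prod (nbhs y0) (nbhs w)) _ A _ _ free).
    move=> a j; case: (split_ordP a) => a' ->.
      rewrite col_mxEu (ord1 a') (_ : (fun p => _) = fun p => G p.2 0 j).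
        exact: (cvg2 (fun y => G y 0 j) _ (gradient_continuous hG w0)).
      by apply/funext => p; rewrite col_mxEu.
    rewrite col_mxEd mxE (_ : (fun p => _) = fun p => G (p.1 - x a') 0 j).
      exact: (cvg1 (fun y => G (y - x _) 0 j) _ (cvg_shift _ j)).
    by apply/funext => p; rewrite col_mxEd mxE.
  - exact: nbhs_right_gt.
  move=> w' y y' c [/= Afree nyx] _ _ _ yk Ey' yy' yw'.
  have yy'0 : y - y' != 0 by rewrite subr_eq0.
  have w'0 : w' != 0.
    by apply: contraNneq yy'0 => w'0; rewrite yw' w'0 scaler0.
  have Gyy' : G (y - y') = G w'.
    by rewrite yw' (gradient_scale hG) // normr_gt0.
  (* Adding [y'] to the pins of [y] gives [k + 1] independent gradients, exceeding the rank [k] of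
     the stratum. *)
  suff /free_pins_le : free_pins E y (1 + k) by rewrite yk ltnn.
  exists (fun a => match fintype.split a with inl _ => y' | inr j => x j end); split.
    move=> a; case: splitP => [j _|j _]; first by rewrite eq_sym.
    by split; [exact: (Hx j).1|rewrite eq_sym -subr_eq0].
  rewrite (_ : \matrix_(a < 1 + k) _ = A (y, w')) //.
  apply/matrixP => a j; rewrite !mxE; case: splitP => a' _ /=.
    by rewrite Gyy' (ord1 a').
  by rewrite mxE.
have [[U C] [/= [[U1 U2] [/= nU1 nU2] UU] nC] UCQ] := Hnear.
have [e /= e0 eU] : exists2 e : R, 0 < e &
    forall y, `|y - y0| < e -> U1 y /\ U2 y.
  have /nbhs_ballP[e /= e0 eU] : nbhs y0 (U1 `&` U2) by exact: filterI.
  by exists e => // y ye; apply: eU; rewrite -ball_normE /= distrC.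
have [c [Cc c0]] := filter_ex (filterI nC (nbhs_right_gt 0)).
have [x' [Ex' sumx']] := pad_pins R x y0 kd.
exists e, c^-1, x'; split => //; first by rewrite invr_ge0 ltW.
  by apply: Ex' => // i; exact: (Hx i).1.
move=> y y' Ey Ey' yk y'k /eU[Uy _] /eU[_ Uy'].
have [<-|yy'] := eqVneq y y'.
  by rewrite subrr normr0 mulr_ge0 ?invr_ge0 ?(ltW c0) // sumr_ge0.
rewrite ler_pdivlMl // (le_trans _ (sumx' (fun z => `|N (y - z) - N (y' - z)|) _)) //.
have t0 : 0 < `|y - y'| by rewrite normr_gt0 subr_eq0.
apply: (UCQ (y, y', c) _ (`|y - y'|^-1 *: (y - y'))) => //=.
- by split => //; exact: UU.
- by rewrite normrZ normfV normr_id mulVf // gt_eqF.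
- by rewrite scalerA mulfV ?gt_eqF // scale1r.
Qed.

End C1Norm.

(** * Polyhedral norms *)

Section PolyhedralNorm.
Context (R : realType) (d M : nat) (N : 'rV[R]_d -> R) (v : 'I_M -> 'rV[R]_d).
Context (hN : is_norm N)
  (hv : forall x, N x = \big[Num.max/0]_(i < M) `|inner x (v i)|).
Implicit Types (x y z u : 'rV[R]_d) (E : set 'rV[R]_d) (I : {set 'I_M}).

Definition active z : {set 'I_M} := [set i | N z == `|inner z (v i)|]%SET.

Lemma inner_le_norm z i : `|inner z (v i)| <= N z.
Proof. by rewrite hv (le_bigmax _ (fun i => `|inner z (v i)|)). Qed.

(** The maximum is attained at some index unless it is the initial value 0, which [N z > 0]
    excludes. *)
Lemma active_neq0 z : z != 0 -> exists i, i \in active z.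
Proof.
move=> z0; apply: contrapT => noi; have := is_norm_gt0 hN z0.
have lt i : `|inner z (v i)| < N z.
  rewrite lt_neqAle inner_le_norm andbT; apply/negP => /eqP e.
  by apply: noi; exists i; rewrite inE e.
move=> N0; have : \big[Num.max/0]_(i < M) `|inner z (v i)| < N z.
  by apply: bigmax_lt.
by rewrite -hv ltxx.
Qed.

Lemma inner_continuous u : continuous (fun z => inner z u).
Proof.
move=> z; apply: (@cvg_inner _ _ _ (nbhs z) _ id (fun=> u)) => i.
  exact: coord_continuous.
exact: cvg_cst.
Qed.

(** The strict inequality at an inactive index persists near [z0], and there are finitely many
    indices. *)
Lemma active_near z0 : \forall z \near z0, active z \subset active z0.
Proof.
have lt_near i : i \notin active z0 -> \forall z \near z0, i \notin active z.
  rewrite inE => ne.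
  have : 0 < N z0 - `|inner z0 (v i)|.
    by rewrite subr_gt0 lt_neqAle eq_sym ne inner_le_norm.
  have cvgN : N z - `|inner z (v i)| @[z --> z0] --> N z0 - `|inner z0 (v i)|.
    have cN : N z @[z --> z0] --> N z0 by exact: is_norm_continuous.
    have cI : `|inner z (v i)| @[z --> z0] --> `|inner z0 (v i)|.
      have ci : inner z (v i) @[z --> z0] --> inner z0 (v i).
        exact: (@inner_continuous (v i) z0).
      exact: (cvg_norm ci).
    exact: cvgB cN cI.
  move=> /(cvgr_gt _ cvgN); apply: filterS => z.
  by rewrite subr_gt0 inE => lt; rewrite gt_eqF.
have : \forall z \near z0, forall i, i \notin active z0 -> i \notin active z.
  apply: (@filter_forall _ _ (fun i z => i \notin active z0 -> i \notin active z)
    (nbhs z0)) => i; have [i0|i0] := boolP (i \in active z0).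
    exact: nearW.
  by apply: filterS (lt_near i i0).
by apply: filterS => z H; apply/fintype.subsetP => i; apply: contraTT; exact: H.
Qed.

(** An active inner product at [z0] is nonzero and keeps its sign nearby, so [N] agrees with one
    fixed linear form wherever [i] is active. *)
Lemma sgr_inner_near z0 i : z0 != 0 -> i \in active z0 ->
  \forall z \near z0, i \in active z ->
    N z = Num.sg (inner z0 (v i)) * inner z (v i).
Proof.
move=> z0N; rewrite inE => /eqP Nz0; set s := Num.sg _.
have s0 : 0 < s * inner z0 (v i) by rewrite /s -normrEsg -Nz0 is_norm_gt0.
have cs : s * inner z (v i) @[z --> z0] --> s * inner z0 (v i).
  have ci : inner z (v i) @[z --> z0] --> inner z0 (v i).
    exact: (@inner_continuous (v i) z0).
  exact: (cvgM (cvg_cst s) ci).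
move: s0 => /(cvgr_gt _ cs); apply: filterS => z sz.
rewrite inE => /eqP ->; rewrite -(gtr0_norm sz) normrM.
rewrite normr_sg; case: eqP => [/eqP e|]; last by rewrite mul1r.
by move: sz; rewrite /s (eqP e) sgr0 mul0r ltxx.
Qed.

(** The values lie in a finite type, as a stratification requires. The condition [x != y] ensures
    that each member is the active set of a nonzero vector, hence nonempty. *)
Definition active_family E y : {set {set 'I_M}} :=
  [set I | `[<exists x, [/\ E x, x != y & active (y - x) = I]>]]%SET.

(** A maximal independent subfamily has at most [d] members and spans the rest; [c] sums the
    absolute values of all coefficients. *)
Lemma inner_span (m : nat) (A : 'I_m -> 'rV[R]_d) :
  exists k (f : 'I_k -> 'I_m) (c : R), [/\ (k <= d)%N, 0 <= c &
    forall u j, `|inner u (A j)| <= c * \sum_i `|inner u (A (f i))|].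
Proof.
pose B := \matrix_(j < m) A j.
exists (\rank B), (maxrankfun B).
have /submxP[D BD] : (B <= rowsub (maxrankfun B) B)%MS by rewrite eq_maxrowsub.
exists (\sum_j \sum_i `|D j i|); split; first exact: rank_leq_col.
  by rewrite sumr_ge0 // => j _; rewrite sumr_ge0.
move=> u j.
have -> : inner u (A j) = \sum_i D j i * inner u (A (maxrankfun B i)).
  under eq_bigr do rewrite mulr_sumr.
  rewrite exchange_big; apply: eq_bigr => l _ /=.
  have := congr1 (fun X : 'M[R]_(m, d) => X j l) BD; rewrite !mxE => ->.
  by rewrite mulr_sumr; apply: eq_bigr => i _; rewrite !mxE mulrCA.
rewrite (le_trans (ler_norm_sum _ _ _)) // mulr_sumr; apply: ler_sum => i _.
rewrite normrM ler_wpM2r // (bigD1 j) //= (bigD1 i) //= -addrA ler_wpDr //.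
by rewrite addr_ge0 ?sumr_ge0 // => j' _; rewrite sumr_ge0.
Qed.

Lemma polyhedral_norm_pins E y0 : E y0 -> exists r c (x : 'I_d -> 'rV[R]_d),
  [/\ 0 < r, 0 <= c, forall i, E (x i) &
    forall y y', E y -> E y' -> active_family E y = active_family E y0 ->
      active_family E y' = active_family E y0 -> `|y - y0| < r -> `|y' - y0| < r ->
      `|y - y'| <= c * \sum_i `|N (y - x i) - N (y' - x i)|].
Proof.
move=> Ey0; set FF := active_family E y0.
have familyP y I : reflect (exists x, [/\ E x, x != y & active (y - x) = I])
    (I \in active_family E y) by rewrite inE; exact: asboolP.
pose mins := [set I in FF | [forall J in FF, (J \subset I) ==> (J == I)]]%SET.
have /choice[x Hx] : forall I, exists x, I \in mins ->
    [/\ E x, y0 - x != 0 & active (y0 - x) = I].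
  move=> I; have [|] := boolP (I \in mins); last by exists 0.
  rewrite inE => /andP[/familyP[x [Ex xy0 e]] _].
  by exists x => _; split => //; rewrite subr_eq0 eq_sym.
(* One active index represents each minimal set; by [inner_span], at most [d] of the vectors
   [v (a j)] control all of them. *)
have /choice[a Ha] : forall j : 'I_#|mins|, exists i, i \in enum_val j.
  move=> j; have [_ /active_neq0 + e] := Hx _ (enum_valP j).
  by rewrite e.
have [k [f [c [kd c0 Hc]]]] := inner_span (fun j => v (a j)).
have [C C0 HC] := is_norm_ge hN.
have [x' [Ex' sumx']] := pad_pins R (fun i => x (enum_val (f i))) y0 kd.
have Hnear : \forall y \near y0, forall j : 'I_#|mins|,
    let I := enum_val j in [/\ x I != y, active (y - x I) \subset I &
    a j \in active (y - x I) ->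
      N (y - x I) = Num.sg (inner (y0 - x I) (v (a j))) * inner (y - x I) (v (a j))].
  apply: (@filter_forall _ _ _ (nbhs y0)) => j /=; set I := enum_val j.
  have [_ xI0 eI] : [/\ E (x I), y0 - x I != 0 & active (y0 - x I) = I].
    exact: Hx (enum_valP j).
  have cvgI : y - x I @[y --> y0] --> y0 - x I.
    exact: (cvgB (@cvg_id _ (nbhs y0)) (cvg_cst (x I))).
  have H1 : \forall y \near y0, active (y - x I) \subset active (y0 - x I).
    exact: (cvgI _ (active_near (y0 - x I))).
  have aI : a j \in active (y0 - x I) by rewrite eI Ha.
  have H2 : \forall y \near y0, a j \in active (y - x I) ->
      N (y - x I) = Num.sg (inner (y0 - x I) (v (a j))) * inner (y - x I) (v (a j)).
    exact: (cvgI _ (sgr_inner_near xI0 aI)).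
  have H3 : \forall y \near y0, x I != y.
    move: (xI0); rewrite -normr_gt0 => /(near_dist_lt y0).
    by apply: filterS => y; apply: contraTneq => ->; rewrite ltxx.
  move: H1 H2 H3; apply: filterS3 => y /= h1 h2 h3; split => //.
  by rewrite -{2}eI.
have /nbhs_ballP[e /= e0 eU] := Hnear.
exists e, (C^-1 * c), x'; split => //; first by rewrite mulr_ge0 ?invr_ge0 ?(ltW C0).
  by apply: Ex' => // i; have [] := Hx _ (enum_valP (f i)).
move=> y y' Ey Ey' yF y'F ye y'e.
(* For [z] in the stratum, [active (z - x I)] belongs to [FF] and is contained in the minimal set
   [I], hence equals it. So [a j] is active and the affine formula applies. *)
have hnear z : `|z - y0| < e -> forall j : 'I_#|mins|,
    active_family E z = FF -> E z ->
    N (z - x (enum_val j)) = Num.sg (inner (y0 - x (enum_val j)) (v (a j))) *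
      inner (z - x (enum_val j)) (v (a j)).
  move=> ze j zF Ez.
  have zB : ball y0 e z by rewrite -ball_normE /= distrC.
  have [xz sub] := eU z zB j.
  apply; have := enum_valP j; set I := enum_val j in xz sub *.
  rewrite inE => /andP[_ /forall_inP minI].
  suff /minI : active (z - x I) \in FF by rewrite sub => /= /eqP ->; exact: Ha.
  rewrite -zF; apply/familyP; exists (x I); split => //.
  by have [] := Hx _ (enum_valP j).
have [<-|yy'] := eqVneq y y'.
  by rewrite subrr normr0 !mulr_ge0 ?invr_ge0 ?(ltW C0) // sumr_ge0.
(* Here [y'] serves as a pin for [y]; a member of least cardinality inside [active (y - y')] is
   minimal for inclusion. *)
have I0F : active (y - y') \in FF.
  by rewrite -yF; apply/familyP; exists y'; split => //; rewrite eq_sym.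
have [I Imins Isub] : exists2 I, I \in mins & I \subset active (y - y').
  pose P I := (I \in FF) && (I \subset active (y - y')).
  have P0 : P (active (y - y')) by rewrite /P I0F subxx.
  case: (arg_minnP (fun I : {set 'I_M} => #|I|) P0) => I /andP[IF Isub] Imin.
  exists I => //; rewrite inE IF /=; apply/forall_inP => J JF; apply/implyP => JI.
  by rewrite eqEcard JI Imin // /P JF (fintype.subset_trans JI).
pose j := enum_rank_in Imins I.
have NE : N (y - y') = `|inner (y - y') (v (a j))|.
  apply/eqP; have : a j \in active (y - y').
    by apply: (fintype.subsetP Isub); have := Ha j; rewrite enum_rankK_in.
  by rewrite inE.
rewrite -mulrA ler_pdivlMl // (le_trans (HC _)) // NE (le_trans (Hc _ _)) //.
rewrite ler_wpM2l // (le_trans _ (sumx' (fun z => `|N (y - z) - N (y' - z)|) _)) //.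
(* Both distances carry the same sign, so their difference is, up to that sign, the inner product
   with [y - y']; the sign is nonzero because [N (y0 - x) > 0]. *)
apply: ler_sum => i _; rewrite !hnear // -mulrBr -innerNl -innerDl.
rewrite opprB addrA subrK normrM normr_sg.
have [_ xI0 eI] := Hx _ (enum_valP (f i)).
have : a (f i) \in active (y0 - x (enum_val (f i))) by rewrite eI Ha.
rewrite inE => /eqP Ny0.
by rewrite -(normr_gt0 (inner _ _)) -Ny0 is_norm_gt0 // mul1r.
Qed.

End PolyhedralNorm.

(** * The dimension bound for both classes of norms *)

Theorem theorem1p1 (R : realType) (d : nat) (hd : (1 <= d)%N)
    (N : 'rV[R]_d -> R) (hN : is_norm N)
    (hreg : C1_away_from_0 N \/ polyhedral N)
    (E : set 'rV[R]_d) (hE : E !=set0) :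
  (forall eps : R, 0 < eps ->
     exists2 x, E x &
       ((d%:R^-1)%:E * packing_dim (@euclidean_dist R d) E - eps%:E
          <= packing_dim (@real_dist R) (pinned_distance_set N E x))%E)
  /\ ((d%:R^-1)%:E * packing_dim (@euclidean_dist R d) E
        <= packing_dim (@real_dist R) (distance_set N E))%E.
Proof.
have d0 : 0 < d%:R :> R by rewrite ltr0n.
have dim_le (s : R) : (forall x, E x ->
    (packing_dim (@real_dist R) (pinned_distance_set N E x) < s%:E)%E) ->
    (packing_dim (@euclidean_dist R d) E <= (d%:R * s)%:E)%E.
  have [hC|[M [v hv]]] := hreg.
    have [G hG] := C1_norm_gradient hN hC.
    exact: packing_dim_le_pins (C1_norm_pins hN hG (E := E)).
  exact: packing_dim_le_pins (polyhedral_norm_pins hN hv (E := E)).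
have pinned eps : 0 < eps -> exists2 x, E x &
    ((d%:R^-1)%:E * packing_dim (@euclidean_dist R d) E - eps%:E
       <= packing_dim (@real_dist R) (pinned_distance_set N E x))%E.
  move=> eps0; apply: contrapT => nox.
  have lt x : E x -> (packing_dim (@real_dist R) (pinned_distance_set N E x) <
      (d%:R^-1)%:E * packing_dim (@euclidean_dist R d) E - eps%:E)%E.
    by move=> Ex; rewrite ltNge; apply/negP => le; apply: nox; exists x.
  case: (packing_dim _ E) dim_le lt => [r| |] dim_le lt.
  (* If all pins failed, the dimension [r] of [E] would be at most [r - d * eps]. *)
  - have := dim_le (d%:R^-1 * r - eps) lt.
    rewrite lee_fin mulrBr mulVKf ?gt_eqF // lerDl oppr_ge0 leNgt.
    by rewrite mulr_gt0.
  - (* [packing_dim E] could a priori be infinite, in which case [lt] gives no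
       uniform bound; the dimension of the line does. *)
    have := dim_le 2; rewrite leNgt ltry => H; suff : false by [].
    apply: H => x _; apply: le_lt_trans (packing_dim_line_le1 _) _.
    by rewrite lte_fin ltr1n.
  - have [x /lt] := hE.
    by rewrite mulrNy gtr0_sg ?invr_gt0 // mul1e addNye ltNge leNye.
(* The bound for the full distance set follows by monotonicity, since [eps] is arbitrary. *)
split => //; apply/lee_addgt0Pr => e /pinned[x Ex].
rewrite leeBlDr // => /le_trans; apply; rewrite leeD2r //.
by apply: le_packing_dim => _ [y Ey <-]; exists x, y.
Qed.
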